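(* Let $(X,\|\cdot\|)$ be a real normed space and let $\sigma$ be a Hausdorff topology on $X$ coarser than the norm topology, such that the closed unit ball $B_X$ is sequentially $\sigma$-compact and also $\sigma$-compact. Let $K$ be a nonempty $\sigma$-closed and convex subset of $X$. Assume that $\psi:K\times K\to\mathbb{R}$ satisfies condition $(K_\sigma)$ and that it is $\sigma$-transfer upper semicontinuous on $K_n$ for each $n\in\mathbb{N}$. Let $R^E_\sigma\subseteq\{0\}$. Then $S(\psi,K)$ is nonempty and $(S(\psi,K))^\infty_\sigma=\{0\}$, if at least one of the following holds. (i) For each $n\in\mathbb{N}$, $\psi|_{K_n\times K_n}(x,y)$ is anti-locally dominated in $y$. (ii) For each $n\in\mathbb{N}$, $\psi|_{K_n\times K_n}(x,y)$ is transfer quasi-convex in $y$. (iii) $\psi$ is cyclically anti-quasimonotone. (iv) For every $x\in K$, $\psi(x,\cdot)$ is quasi-convex, and $\psi(x,x)\ge 0$ for each $x\in K$. (v) $-\psi$ is pseudomonotone, for every $y\in K$ the function $\psi(\cdot,y)$ is quasi-concave, and $\psi(x,x)=0$ for each $x\in K$.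
   Context: Notation. $K_n:=\{x\in K:\|x\|\le n\}$ for $n\in\mathbb{N}=\{1,2,\dots\}$. For $A\subseteq K$, $S(\psi,A):=\{\bar x\in A:\psi(\bar x,y)\ge 0\ \ \forall y\in A\}$. $x_k\xrightarrow{\sigma}x$ denotes convergence in the topology $\sigma$; $\mathrm{co}$ denotes convex hull. Asymptotic cone. For $A\subseteq X$, $A^\infty_\sigma:=\{u\in X:\ \exists\, t_k\to+\infty \text{ and } (x_k)\subseteq A \text{ with } \frac{x_k}{t_k}\xrightarrow{\sigma}u\}$, and $\emptyset^\infty_\sigma=\emptyset$. $\sigma g$-asymptotic function. For a proper function $f:X\to\mathbb{R}\cup\{+\infty\}$ (i.e. not identically $+\infty$), $[f\le\lambda]:=\{x: f(x)\le\lambda\}$ and $f^{\sigma g}(u):=\inf\{\lambda\in\mathbb{R}: u\in([f\le\lambda])^\infty_\sigma\}$ for $u\in X$ (with $\inf\emptyset=+\infty$). A function defined only on $K$ is extended by $+\infty$ on $X\setminus K$ before forming $f^{\sigma g}$. The set $R^E_\sigma$. $R^E_\sigma:=\{u\in K^\infty_\sigma: (-\psi(\cdot,y))^{\sigma g}(u)\le 0\ \ \forall y\in K\}$. Condition $(K_\sigma)$. $\psi$ satisfies $(K_\sigma)$ if for any unbounded sequence $(x_n)$ such that $x_n\in S(\psi,K_n)$ for each $n\in\mathbb{N}$, there exist a subsequence $(x_{n_k})$ of $(x_n)$, a sequence $(w_k)\subseteq K$ and $0\neq d\in K^\infty_\sigma$ such that for each $k\in\mathbb{N}$, $\psi(x_{n_k},y)\le\psi(w_k,y)$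 for all $y\in K_{n_k}$, and $\frac{w_k}{\|w_k\|}\xrightarrow{\sigma}d$ as $k\to\infty$. Definitions for a bifunction. Let $A\subseteq X$ and $\varphi:A\times A\to\mathbb{R}$. - $\varphi$ is $\sigma$-transfer upper semicontinuous on $A$ if for all $(x_0,y)\in A\times A$, $\varphi(x_0,y)<0$ implies that there exist $y'\in A$ and a (relative) $\sigma$-neighborhood $\mathcal{V}_\sigma(x_0)\subseteq A$ of $x_0$ such that $\varphi(x,y')<0$ for all $x\in\mathcal{V}_\sigma(x_0)$. ''$\psi$ is $\sigma$-transfer upper semicontinuous on $K_n$'' means this for $\varphi=\psi|_{K_n\times K_n}$, $A=K_n$. - $\varphi(x,y)$ is anti-locally dominated in $y$ if for any finite subset $\{y_1,\dots,y_m\}\subseteq A$ there exists $x\in A$ such that $\max_{1\le i\le m}(-\varphi(x,y_i))\le0$. - $\varphi(x,y)$ is transfer quasi-convex in $y$ if for any finite subset $\{y_1,\dots,y_m\}\subseteq A$ there exists a corresponding finite subset $\{x_1,\dots,x_m\}\subseteq A$ such that for any (nonempty) $L\subseteq\{1,\dots,m\}$ and any $x\in\mathrm{co}\{x_i:i\in L\}$, $\min_{i\in L}(-\varphi(x,y_i))\le 0$. - $\varphi$ is cyclically anti-quasimonotone if for any points $x_1,\dots,x_m\in A$, possibly not all different, there is $i\in\{1,\dots,m\}$ with $\varphi(x_i,x_{i+1})\ge0$, where $x_{m+1}:=x_1$. - $\varphi$ is pseudomonotone if for all $x,y\in A$, $\varphi(x,y)\ge0$ implies $\varphi(y,x)\le0$.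 A function $g:K\to\mathbb{R}$ is quasi-convex if $[g\le\lambda]$ is convex for all $\lambda\in\mathbb{R}$, and quasi-concave if $-g$ is quasi-convex.
   Formalization: Added: the maps x ↦ cx (c>0) are σ-continuous, as in any vector topology (false for bare σ, where K_n need not be σ-compact). In (K_σ), sequences are indexed only by n with K_n nonempty (otherwise vacuous, and the claim false, if K misses the unit ball). *)

(* Defs.v *)
(* MathComp-Analysis *)
From mathcomp Require Import all_boot all_order all_algebra.
From mathcomp Require Import all_classical all_reals all_analysis.

Set Implicit Arguments.
Unset Strict Implicit.
Unset Printing Implicit Defensive.

Import Order.TTheory GRing.Theory Num.Theory.
Import numFieldNormedType.Exports.

Local Open Scope classical_set_scope.
Local Open Scope ring_scope.

(* A second topology on the carrier of a type [X] that may already carry one.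
   [retop sigma] is the type [X] itself (up to conversion) seen as a topological
   space for [sigma].  (The structure also bundles an equality and a choice
   operator on [X]; no notion below depends on them.) *)
Definition topology_on (X : Type) : Type := Topological.axioms_ X.

Definition retop (X : Type) (sigma : topology_on X) : topologicalType :=
  Topological.Pack sigma.

Section SecondTopology.
Context {X : Type} (sigma : topology_on X).

Definition cvg_in (x : nat -> X) (u : X) : Prop :=
  (x : nat -> retop sigma) @ \oo --> (u : retop sigma).

Definition sequentially_compact (A : set X) : Prop :=
  forall x : nat -> X, (forall k, A (x k)) ->
    exists2 phi : nat -> nat, increasing_seq phi &
      exists2 u, A u & cvg_in (x \o phi) u.

End SecondTopology.

Definition coarser_than_norm (R : realType) (X : normedModType R)
    (sigma : topology_on X) : Prop :=
  forall U : set X, open (U : set (retop sigma)) -> open U.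

(* A topology in this file is not assumed to be linear.  Continuity of the
   positive homotheties is the only compatibility with the vector space
   structure that is asked for; every vector topology has it.  It makes
   compactness of the unit ball equivalent to compactness of all closed balls
   centered at 0, which fails for general Hausdorff topologies (take for [sigma]
   the sets that are norm open and whose trace on the closed unit ball of l2 is
   relatively weakly open). *)
Definition homothety_continuous (R : realType) (X : normedModType R)
    (sigma : topology_on X) : Prop :=
  forall c : R, 0 < c ->
    continuous ((fun x : X => c *: x) : retop sigma -> retop sigma).

Definition unit_ball (R : realType) (X : normedModType R) : set X :=
  [set x | `|x| <= 1].

Definition convex_hull (R : realType) (X : normedModType R) (A : set X) :
    set X :=
  smallest (fun C : set X => convex_set (C : set (convex_lmodType X))) A.

Definition quasi_convex_on (R : realType) (X : normedModType R) (K : set X)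
    (g : X -> R) : Prop :=
  forall lambda : R,
    convex_set ([set x | K x /\ g x <= lambda] : set (convex_lmodType X)).

Definition quasi_concave_on (R : realType) (X : normedModType R) (K : set X)
    (g : X -> R) : Prop :=
  quasi_convex_on K (fun x => - g x).

Section Asymptotic.
Context {R : realType} {X : normedModType R} (sigma : topology_on X).

Definition asymptotic_cone (A : set X) : set X :=
  [set u | exists t : nat -> R, exists x : nat -> X,
    [/\ t @ \oo --> +oo, (forall k, A (x k)) &
        cvg_in sigma (fun k => (t k)^-1 *: x k) u]].

Definition sublevel (f : X -> \bar R) (lambda : R) : set X :=
  [set x | (f x <= lambda%:E)%E].

Definition sg_asymptotic (f : X -> \bar R) (u : X) : \bar R :=
  ereal_inf [set lambda%:E |
    lambda in [set l : R | asymptotic_cone (sublevel f l) u]].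

Definition extend_pinfty (K : set X) (g : X -> R) : X -> \bar R :=
  patch (fun=> +oo%E) K (EFin \o g).

End Asymptotic.

(* A bifunction on [A] is represented by a total function [X -> X -> R]; every
   notion below only involves its values on [A * A]. *)
Section Bifunction.
Context {R : realType} {X : normedModType R} (sigma : topology_on X).
Implicit Types (phi psi : X -> X -> R) (A K : set X).

Definition truncation K (n : nat) : set X := [set x | K x /\ `|x| <= n%:R].

Definition equilibria psi A : set X :=
  [set x | A x /\ forall y, A y -> 0 <= psi x y].

Definition recession_set psi K : set X :=
  [set u | asymptotic_cone sigma K u /\
    forall y, K y ->
      (sg_asymptotic sigma (extend_pinfty K (fun x => - psi x y)%R) u <= 0)%E].

(* [K] may miss small balls around the origin, and then [equilibria] of the
   corresponding truncations is empty.  The sequences in [condition_K] are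
   therefore indexed by those [n >= 1] for which [truncation K n] is nonempty
   (all [n >= n0] for some [n0]; all [n >= 1] as soon as [K] meets the unit
   ball).  Values of [x] at other indices are irrelevant. *)
Definition truncation_index K : set nat :=
  [set n | (0 < n)%N /\ truncation K n !=set0].

Definition condition_K psi K : Prop :=
  forall x : nat -> X,
    (forall n, truncation_index K n -> equilibria psi (truncation K n) (x n)) ->
    ~ (exists M : R, forall n, truncation_index K n -> `|x n| <= M) ->
    exists phi : nat -> nat, exists w : nat -> X, exists d : X,
      [/\ increasing_seq phi /\ (forall k, truncation_index K (phi k)),
          (forall k, K (w k) /\ w k != 0),
          d != 0 /\ asymptotic_cone sigma K d,
          (forall k y, truncation K (phi k) y -> psi (x (phi k)) y <= psi (w k) y) &
          cvg_in sigma (fun k => `|w k|^-1 *: w k) d].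

Definition transfer_usc phi A : Prop :=
  forall x0 y, A x0 -> A y -> phi x0 y < 0 ->
    exists2 y', A y' &
      \forall x \near within A (nbhs (x0 : retop sigma)), phi x y' < 0.

(* Finite subsets [{y_1, ..., y_m}] are nonempty and given as families, with
   repetitions allowed. *)
Definition anti_locally_dominated phi A : Prop :=
  forall (m : nat) (y : 'I_m.+1 -> X), (forall i, A (y i)) ->
    exists2 x, A x &
      (\big[maxe/-oo]_(i < m.+1) (- phi x (y i))%R%:E <= 0)%E.

Definition transfer_quasi_convex phi A : Prop :=
  forall (m : nat) (y : 'I_m.+1 -> X), (forall i, A (y i)) ->
    exists2 x : 'I_m.+1 -> X, (forall i, A (x i)) &
      forall L : {set 'I_m.+1}, L != finset.set0 ->
      forall z, convex_hull [set x i | i in [set` L]] z ->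
        (\big[mine/+oo]_(i in L) (- phi z (y i))%R%:E <= 0)%E.

(* [ordS i] is the cyclic successor of [i]. *)
Definition cyclically_anti_quasimonotone phi A : Prop :=
  forall (m : nat) (x : 'I_m.+1 -> X), (forall i, A (x i)) ->
    exists i, 0 <= phi (x i) (x (ordS i)).

Definition pseudomonotone phi A : Prop :=
  forall x y, A x -> A y -> 0 <= phi x y -> phi y x <= 0.

End Bifunction.

(* Main.v *)
Require Import Defs.
From mathcomp Require Import all_boot all_order all_algebra.
From mathcomp Require Import all_classical all_reals all_analysis.
From mathcomp Require Import finmap zify ring lra.

Set Implicit Arguments.
Unset Strict Implicit.
Unset Printing Implicit Defensive.

Import Order.TTheory GRing.Theory Num.Theory.
Import numFieldNormedType.Exports.

(** Equilibria on the truncations.  Suppose that [A] is compact for [sigma] and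
    that [psi] is transfer upper semicontinuous on [A].  A point lying in the
    [sigma]-closure of every superlevel set [{z in A : 0 <= psi z y}] is then an
    equilibrium on [A], since transfer upper semicontinuity is exactly what
    separates a non-equilibrium from one of these closures.  By compactness it
    is enough to find, for finitely many [y_i], a point common to the closures
    ([compact_equilibria]).  In case (i) such a point is given; in case (iii)
    one of the [y_i] is such a point, since otherwise following strictly
    negative values of [psi] from one [y_i] to the next would close up into a
    forbidden cycle ([cyclic_dominating_point]).  In cases (ii), (iv) and (v)
    the closures satisfy the hypothesis of the Knaster-Kuratowski-Mazurkiewicz
    theorem [kkm]; case (v) is case (iv) for the bifunction [- psi y x].

    The KKM theorem.  Its combinatorial core is Scarf's variant of Sperner's
    lemma ([rainbow_primitive]): finitely many points carry one linear order
    per colour, primitive families of points play the part of the simplices of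
    a triangulation, and walking from one to the next through doors proves that
    some primitive family shows all the colours.  For the points of the
    standard simplex with coordinates in [1/n Z], ordered by decreasing
    coordinates, the members of a primitive family are close to each other
    ([rainbow_grid]), and compactness of the simplex concludes when [n] grows.

    From the truncations to [K].  Choose an equilibrium [x n] on each nonempty
    truncation.  If the sequence is bounded, its cluster points are equilibria
    on [K] ([equilibria_of_filter]).  Otherwise the condition on [psi] yields
    points [w k] that are at least as good as a subsequence of [x] and whose
    directions converge to some [d <> 0].  If infinitely many [w k] stay in one
    ball, their cluster points are equilibria again; if not, the norms tend to
    infinity and [d] is a nonzero element of the recession set
    ([recession_of_sequence]), against the hypothesis.  That same lemma puts
    the asymptotic cone of the set of equilibria into the recession set, so
    that this cone is trivial. *)

(** * Primitive families and doors *)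

Lemma even_card_involution (S : finType) (f : S -> S) (A : {set S}) :
  {in A, forall x, f x \in A} -> {in A, forall x, f (f x) = x} ->
  {in A, forall x, f x != x} -> ~~ odd #|A|.
Proof.
have [n] := ubnP #|A|; elim: n A => // n IH A leAn fA fK fN.
have [->|/set0Pn[x xA]] := eqVneq A finset.set0; first by rewrite cards0.
pose B := A :\ x :\ f x.
have fxA : f x \in A :\ x by rewrite !inE fN // fA.
have cA : #|A| = #|B|.+2 by rewrite (cardsD1 x A) xA (cardsD1 (f x)) fxA.
rewrite cA /= negbK; apply: IH.
- by move: leAn; rewrite cA; lia.
- move=> y; rewrite !inE => /and3P[yfx yx yA].
  rewrite fA // andbT; apply/andP; split.
    by apply: contraNneq yx => e; rewrite -(fK y yA) e fK.
  by apply: contraNneq yfx => <-; rewrite fK.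
- by move=> y; rewrite !inE => /and3P[_ _ /fK].
- by move=> y; rewrite !inE => /and3P[_ _ /fN].
Qed.

(** The points of [V] are ranked once for each index in [I].  The point
    [delta i] stands for the vertex [i] of a simplex: lowest for its own
    ranking, above all non-vertices for the others. *)
Section Primitive.
Variables (I V : finType) (r : I -> V -> nat) (delta : I -> V) (c : V -> I).
Hypothesis r_inj : forall i, injective (r i).
Hypothesis delta_min : forall i v, r i (delta i) <= r i v.
Hypothesis delta_top : forall i k v,
  k != i -> v \notin codom delta -> r i v < r i (delta k).
Hypothesis c_delta : cancel delta c.

(** Scarf's primitive families: each [p i] is the lowest member for the ranking
    [i], and no point is above all these minima at once.  Indexing the members
    by the ranking they minimize turns a crossing between neighbouring families
    into a change of two values of [p]. *)
Definition primitive (p : I -> V) : bool :=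
  [forall i, forall k, (k != i) ==> (r i (p i) < r i (p k))] &&
  [forall t, exists i, r i t <= r i (p i)].

Lemma primitiveP (p : I -> V) :
  reflect ((forall i k, k != i -> r i (p i) < r i (p k)) /\
           (forall t, exists i, r i t <= r i (p i)))
          (primitive p).
Proof.
apply: (iffP andP) => -[p1 p2]; split.
- by move=> i k ki; have /forallP/(_ k)/implyP := forallP p1 i; apply.
- by move=> t; apply/existsP; apply: (forallP p2).
- by apply/forallP => i; apply/forallP => k; apply/implyP; apply: p1.
- by apply/forallP => t; apply/existsP; apply: p2.
Qed.

Lemma primitive_inj (p : I -> V) : primitive p -> injective p.
Proof.
move=> /primitiveP[p1 _] i k e; apply/eqP; apply: contraT => ik.
by have := p1 k i ik; rewrite e ltnn.
Qed.

(** A state [(p, j)] is the primitive family [p] seen from its facet opposite to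
    [p j]; the facet is a door when it shows every colour but possibly [i0].
    By counting, it then shows these colours exactly once each, and never
    [i0]. *)
Definition door (i0 : I) (s : {ffun I -> V} * I) : bool :=
  primitive s.1 &&
  [forall a, (a != i0) ==> [exists i, (i != s.2) && (c (s.1 i) == a)]].

Lemma doorP (i0 : I) (s : {ffun I -> V} * I) :
  reflect (primitive s.1 /\
           forall a, a != i0 -> exists2 i, i != s.2 & c (s.1 i) = a)
          (door i0 s).
Proof.
apply: (iffP andP) => -[sp sc]; split=> //.
- move=> a ai0; have /implyP/(_ ai0)/existsP[i /andP[ij /eqP e]] := forallP sc a.
  by exists i.
- apply/forallP => a; apply/implyP => /sc[i ij e].
  by apply/existsP; exists i; rewrite ij e eqxx.
Qed.

Lemma door_inj (i0 : I) s : door i0 s ->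
  {in [set~ s.2] &, injective (fun i => c (s.1 i))}.
Proof.
move=> /doorP[_ sc].
have sub : [set~ i0] \subset (fun i => c (s.1 i)) @: [set~ s.2].
  apply/fintype.subsetP => a; rewrite !inE => /sc[i ij <-].
  by apply: imset_f; rewrite !inE.
have cE : #|[set~ i0]| = #|[set~ s.2]| by rewrite !cardsC1.
apply/imset_injP; rewrite eqn_leq leq_imset_card /=.
by rewrite -cE; apply: subset_leq_card.
Qed.

(** The other door of the same family: a door whose opposite vertex does not have
    colour [i0] meets that colour exactly once more, and exchanging the two
    vertices of that colour gives the only other door. *)
Definition twin (s : {ffun I -> V} * I) : {ffun I -> V} * I :=
  (s.1, odflt s.2 [pick i | (i != s.2) && (c (s.1 i) == c (s.1 s.2))]).

Lemma twinP i0 s : door i0 s -> c (s.1 s.2) != i0 ->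
  [/\ door i0 (twin s), twin (twin s) = s & twin s != s].
Proof.
move=> ds cj; have [sp sc] := doorP _ _ ds; have inj := door_inj ds.
rewrite /twin; case: s ds cj sp sc inj => p j /= ds cj sp sc inj.
case: pickP => [k /andP[kj /eqP ek]|none]; last first.
  by have [i ij e] := sc _ cj; have := none i; rewrite ij e eqxx.
split=> /=; last by apply/eqP => -[e]; rewrite e eqxx in kj.
- apply/doorP; split=> //= a /sc[i ij e].
  by have [ik|ik] := eqVneq i k; [exists j; rewrite 1?eq_sym // -ek -ik|exists i].
- case: pickP => [l /andP[lk /eqP el]|none] /=; last first.
    by have := none j; rewrite eq_sym kj ek eqxx.
  congr pair; apply/eqP; apply: contraT => lj.
  by case/eqP: lk; apply: inj; rewrite ?inE.
Qed.

(** When [s.1 s.2] leaves the family, the ranking [s.2] needs a new minimum among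
    the members that stay. *)
Definition heir (s : {ffun I -> V} * I) : I :=
  odflt s.2 [pick k | (k != s.2) &&
    [forall i, (i != s.2) ==> (r s.2 (s.1 k) <= r s.2 (s.1 i))]].

(** The points above all the minima of the facet, except the one that [heir s]
    held for its own ranking: adding such a point keeps every other minimum. *)
Definition entry (s : {ffun I -> V} * I) (t : V) : bool :=
  [forall i, (i != heir s) ==>
    (r i (if i == s.2 then s.1 (heir s) else s.1 i) < r i t)].

(** Passing through the door to the neighbouring family.  In the facet the member
    [heir s] is the minimum of the two rankings [heir s] and [s.2].  It keeps
    the latter, and the highest point of [entry s] takes over the former; the
    maximality is what makes the new family primitive. *)
Definition cross (s : {ffun I -> V} * I) : {ffun I -> V} * I :=
  let x := odflt (s.1 s.2) [pick t | entry s t &&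
    [forall t', entry s t' ==> (r (heir s) t' <= r (heir s) t)]] in
  ([ffun i => if i == s.2 then s.1 (heir s) else
              if i == heir s then x else s.1 i], heir s).

Lemma heir_spec s : 1 < #|I| -> heir s != s.2 /\
  forall i, i != s.2 -> r s.2 (s.1 (heir s)) <= r s.2 (s.1 i).
Proof.
move=> I2; rewrite /heir; case: pickP => [k /andP[kj /forallP km]|none] /=.
  by split=> // i /(implyP (km i)).
have /card_gt0P[k0] : 0 < #|[set~ s.2]| by rewrite cardsC1; lia.
rewrite !inE => k0j.
have [k kj km] := @arg_minnP _ k0 (fun i => i != s.2) (fun i => r s.2 (s.1 i)) k0j.
have := none k; rewrite kj /= => /negbT/negP[].
by apply/forallP => i; apply/implyP => /km.
Qed.

Lemma heir_uniq (s : {ffun I -> V} * I) k : injective s.1 -> 1 < #|I| -> k != s.2 ->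
  (forall i, i != s.2 -> r s.2 (s.1 k) <= r s.2 (s.1 i)) -> heir s = k.
Proof.
move=> sinj I2 kj km; have [hj hm] := heir_spec s I2.
by apply: sinj; apply: (@r_inj s.2); apply/eqP; rewrite eqn_leq hm // km.
Qed.

(** Crossing is an involution: seen from the new family, [s.2] and [heir s]
    exchange their parts, and the point removed by the crossing is the highest
    one allowed on the way back, by the primitivity of the original family. *)
Lemma crossP i0 s t0 : 1 < #|I| -> door i0 s -> entry s t0 ->
  [/\ door i0 (cross s), cross (cross s) = s & cross s != s].
Proof.
move=> I2 ds t0e; have [sp sc] := doorP _ _ ds.
have [kj km] := heir_spec s I2.
have /primitiveP[p1 p2] := sp.
have [x xe xm] : exists2 x, entry s x &
    forall t, entry s t -> r (heir s) t <= r (heir s) x.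
  by have [x xe xm] := arg_maxnP (r (heir s)) t0e; exists x.
have sn : cross s != s.
  by apply/eqP => e; move: kj; rewrite -[in X in _ != X]e eqxx.
have crossE : cross s =
    ([ffun i => if i == s.2 then s.1 (heir s) else
              if i == heir s then x else s.1 i], heir s).
  rewrite /cross; case: pickP => [y /andP[ye /forallP ym]|none].
    suff -> : y = x by [].
    apply: (@r_inj (heir s)); apply/eqP; rewrite eqn_leq xm //.
    by have := ym x; rewrite xe.
  have := none x; rewrite xe /= => /negbT/negP[].
  by apply/forallP => t; apply/implyP => /xm.
have [k hk] : exists k, heir s = k by exists (heir s).
move: xe xm kj km crossE sn; rewrite /entry hk; case: s ds t0e sp sc p1 p2 hk => p j /=.
move=> ds _ sp sc p1 p2 hk xe xm kj km crossE sn.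
have {}xe i : i != k -> r i (if i == j then p k else p i) < r i x.
  by move=> ik; have /implyP := forallP xe i; apply.
have {}xm t : (forall i, i != k -> r i (if i == j then p k else p i) < r i t) ->
    r k t <= r k x.
  by move=> te; apply: xm; apply/forallP => i; apply/implyP; apply: te.
have {}km i : i != j -> i != k -> r j (p k) < r j (p i).
  move=> ij ik; rewrite ltn_neqAle km // andbT; apply/eqP => /r_inj.
  by move/(primitive_inj sp) => e; rewrite e eqxx in ik.
have jk : (j == k) = false by rewrite eq_sym (negbTE kj).
have xk : r k x < r k (p k).
  (* p is primitive, so x is below one minimum of p; only that of k is left. *)
  have xj : r j (p k) < r j x by have := xe j; rewrite eqxx jk; apply.
  rewrite ltn_neqAle; apply/andP; split.
    by apply/eqP => /r_inj xpk; rewrite xpk ltnn in xj.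
  have [i le] := p2 x; have [<-//|ik] := eqVneq i k.
  have := xe i ik; have [ij|ij] := eqVneq i j; last by lia.
  by have := p1 j k kj; rewrite -ij; lia.
pose q := [ffun i => if i == j then p k else if i == k then x else p i].
have qj : q j = p k by rewrite ffunE eqxx.
have qk : q k = x by rewrite ffunE (negbTE kj) eqxx.
have qi i : i != j -> i != k -> q i = p i.
  by move=> ij ik; rewrite ffunE (negbTE ij) (negbTE ik).
have qp : primitive q.
  apply/primitiveP; split=> [i l li|t].
  - have [ik|ik] := eqVneq i k.
      subst i; rewrite qk; have [->|lj] := eqVneq l j; first by rewrite qj.
      by rewrite qi //; apply: ltn_trans xk _; apply: p1.
    have [lk|lk] := eqVneq l k.
      subst l; rewrite qk; have := xe i ik; rewrite ffunE.
      by have [//|ij] := eqVneq i j; rewrite (negbTE ik).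
    have [ij|ij] := eqVneq i j.
      by subst i; rewrite qj qi // km.
    rewrite qi //; have [->|lj] := eqVneq l j; first by rewrite qj p1 // eq_sym.
    by rewrite qi // p1.
  - apply/existsP; apply: contraT => /existsPn nt.
    have {}nt i : r i (q i) < r i t by rewrite ltnNge nt.
    have := nt k; rewrite qk ltnNge xm // => i ik; have := nt i; rewrite ffunE.
    by rewrite (negbTE ik).
rewrite -/q in crossE.
have qd : door i0 (q, k).
  apply/doorP; split=> //= a /sc[i /= ij e].
  have [ik|ik] := eqVneq i k; first by exists j; rewrite ?jk // qj -ik.
  by exists i => //; rewrite qi.
split=> //; first by rewrite crossE.
(* The way back: the heir is j, and p j is the highest entry. *)
have hq : heir (q, k) = j.
  apply: heir_uniq => //=; first exact: primitive_inj.
    by rewrite jk.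
  move=> i ik; have [->//|ij] := eqVneq i j.
  by rewrite qj qi // ltnW // p1.
rewrite crossE /cross hq /=.
have pe : entry (q, k) (p j).
  rewrite /entry hq; apply/forallP => i; apply/implyP => ij /=.
  have [ik|ik] := eqVneq i k; first by subst i; rewrite qj p1 // jk.
  by rewrite qi // p1 // eq_sym.
have pm t : entry (q, k) t -> r j t <= r j (p j).
  rewrite /entry hq => /forallP te; have [i le] := p2 t.
  have [<-//|ij] := eqVneq i j; have /implyP/(_ ij) /= := te i.
  have [ik|ik] := eqVneq i k; first by subst i; rewrite qj; lia.
  by rewrite qi //; lia.
congr pair; apply/ffunP => i; rewrite !ffunE !jk !eqxx /=.
have [->//|ik] := eqVneq i k; have [->|//] := eqVneq i j.
case: pickP => [y /andP[ye /forallP ym]|none] /=.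
  apply: (@r_inj j); apply/eqP; rewrite eqn_leq pm //.
  by have /implyP/(_ pe) := ym (p j).
have := none (p j); rewrite pe /= => /negbT/negP[].
by apply/forallP => t; apply/implyP => /pm.
Qed.

(** The doors on the boundary of the simplex are those made of vertices only. *)
Definition inner (s : {ffun I -> V} * I) : bool :=
  [exists l, (l != s.2) && (s.1 l \notin codom delta)].

(** A door that is not on the boundary can be crossed: the vertex of index
    [heir s] is above every minimum that the new point has to exceed. *)
Lemma inner_entry (s : {ffun I -> V} * I) : 1 < #|I| -> primitive s.1 ->
  inner s -> entry s (delta (heir s)).
Proof.
move=> I2 sp /existsP[l /andP[lj nl]]; have [kj km] := heir_spec s I2.
have /primitiveP[p1 _] := sp.
(* A point no higher than a non-vertex is below the vertices of the other
   indices. *)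
have low i k v : k != i -> r i v <= r i (s.1 l) -> r i v < r i (delta k).
  by move=> ki le; apply: leq_ltn_trans le _; apply: delta_top.
apply/forallP => i; apply/implyP => ik; apply: low; first by rewrite eq_sym.
have [->|ij] := eqVneq i s.2; first exact: km.
by have [->//|li] := eqVneq l i; rewrite ltnW // p1.
Qed.

Lemma inner_cross s : 1 < #|I| -> inner s -> inner (cross s).
Proof.
move=> I2 /existsP[l /andP[lj nl]]; have [kj km] := heir_spec s I2.
apply/existsP; rewrite /cross /=.
have [lk|lk] := eqVneq l (heir s).
  by exists s.2; rewrite ffunE eqxx eq_sym kj -lk.
by exists l; rewrite ffunE (negbTE lk) (negbTE lj).
Qed.

(** The only door on the boundary is the facet of the vertices other than
    [delta i0]; the family behind it is completed by the highest non-vertex for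
    the ranking [i0].  All the vertices together do not form a primitive family,
    since a non-vertex is above all of them. *)
Lemma outer_door_unique i0 t0 : 1 < #|I| -> t0 \notin codom delta ->
  exists2 e, door i0 e & forall s, door i0 s -> (s != e) = inner s.
Proof.
move=> I2 t0n.
have dI : injective delta := can_inj c_delta.
have [x xn xm] := @arg_maxnP _ t0 (fun t => t \notin codom delta) (r i0) t0n.
have dn i t : t \notin codom delta -> r i (delta i) < r i t.
  move=> tn; rewrite ltn_neqAle delta_min andbT.
  by apply: contraNneq tn => /r_inj <-; apply: codom_f.
have ep : primitive [ffun i => if i == i0 then x else delta i].
  apply/primitiveP; split=> [i k ki|t].
    rewrite !ffunE; have [ii|ii] := eqVneq i i0.
      by subst i; rewrite (negbTE ki) delta_top.
    have [_|k0] := eqVneq k i0; first exact: dn.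
    rewrite ltn_neqAle delta_min andbT; apply: contraNneq ki => /r_inj/dI ->.
    exact: eqxx.
  have [/codomP[k ->]|tn] := boolP (t \in codom delta); last first.
    by exists i0; rewrite ffunE eqxx; apply: xm.
  by exists k; rewrite ffunE; case: eqP => // ->; apply: delta_min.
exists ([ffun i => if i == i0 then x else delta i], i0).
  apply/doorP; split=> //= a ai0; exists a => //.
  by rewrite ffunE (negbTE ai0) c_delta.
move=> s ds; apply/idP/idP; last first.
  move=> /existsP[l /andP[lj nl]]; apply: contraNneq nl => e; move: lj.
  by rewrite e /= => li; rewrite ffunE (negbTE li) codom_f.
apply: contraR => /existsPn nin; apply/eqP.
have [sp sc] := doorP _ _ ds; have /primitiveP[p1 p2] := sp.
case: s ds sp sc nin p1 p2 => p j /= ds sp sc nin p1 p2.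
have {}nin l : l != j -> exists k, p l = delta k.
  move=> lj; have := nin l; rewrite lj /= negbK => /codomP[k ->].
  by exists k.
have p1' i k : r i (p i) <= r i (p k).
  by have [->//|ki] := eqVneq k i; rewrite ltnW // p1.
have pd i l : p l = delta i -> p i = delta i.
  move=> e; apply: (@r_inj i); apply/eqP.
  by rewrite eqn_leq delta_min andbT -e p1'.
have pdelta a : a != i0 -> p a = delta a.
  move=> /sc[l lj e]; have [k ek] := nin l lj; apply: (pd _ l).
  by rewrite ek -e ek c_delta.
have pi0 : p i0 \notin codom delta.
  apply/negP => /codomP[b eb].
  have bE : p i0 = delta i0.
    have [bi|bi] := eqVneq b i0; first by rewrite eb bi.
    have eb0 := primitive_inj sp (etrans eb (esym (pdelta b bi))).
    by rewrite eb0 eqxx in bi.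
  have [i] := p2 t0; have -> : p i = delta i.
    by have [->|/pdelta] := eqVneq i i0.
  by rewrite leqNgt dn.
have ji0 : j = i0.
  apply/eqP; apply: contraNT pi0; rewrite eq_sym => /nin[k ->].
  exact: codom_f.
subst j; congr pair; apply/ffunP => i; rewrite ffunE.
have [->|/pdelta//] := eqVneq i i0.
apply: (@r_inj i0); apply/eqP; rewrite eqn_leq [X in X && _]xm //=.
have [k le] := p2 x; have [<-//|/pdelta pk] := eqVneq k i0.
by move: le; rewrite pk leqNgt dn.
Qed.

(** Parity of the set [E] of doors: [twin] would pair off all of [E] if no
    primitive family showed all the colours, whereas [cross] pairs off all of
    [E] but one element. *)
Lemma rainbow_primitive t0 : 1 < #|I| -> t0 \notin codom delta ->
  exists p : I -> V, primitive p /\ forall a, exists i, c (p i) = a.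
Proof.
move=> I2 t0n.
have /card_gt0P[i0 _] : 0 < #|I| by apply: ltnW.
have [e de eP] := outer_door_unique i0 I2 t0n.
pose E := [set s | door i0 s].
have [/existsP[s /andP[ds /eqP cs]]|noc] :=
    boolP [exists s, door i0 s && (c (s.1 s.2) == i0)].
  have [sp sc] := doorP _ _ ds; exists s.1; split=> // a.
  by have [->|/sc[i _ <-]] := eqVneq a i0; [exists s.2|exists i].
have {}noc s : door i0 s -> c (s.1 s.2) != i0.
  by move=> ds; have /existsPn/(_ s) := noc; rewrite ds.
have even_E : ~~ odd #|E|.
  apply: (@even_card_involution _ twin) => s; rewrite inE => ds;
    by have [dt tK tn] := twinP ds (noc s ds); rewrite ?inE.
have even_Ee : ~~ odd #|E :\ e|.
  apply: (@even_card_involution _ cross) => s; rewrite in_setD1 inE => /andP[se ds];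
    move: (se); rewrite eP // => si;
    rewrite ?in_setD1;
    have /(crossP I2 ds)[dt tK tn] := inner_entry I2 (proj1 (doorP _ _ ds)) si => //.
  have -> : cross s \in E by rewrite inE.
  by rewrite andbT eP // inner_cross.
have eE : e \in E by rewrite inE.
by move: even_E; rewrite (cardsD1 e E) eE /= (negbTE even_Ee).
Qed.

End Primitive.

(** * The grid on the standard simplex *)

Lemma sum_nat_below (I : finType) (f : I -> nat) (n : nat) :
  n <= \sum_i f i -> exists2 b : I -> nat, (forall i, b i <= f i) & \sum_i b i = n.
Proof.
elim: n => [|n IH] lef; first by exists (fun=> 0) => //; rewrite big1.
have [b bf bn] := IH (ltnW lef).
have [i bi] : exists i, b i < f i.
  apply/existsP; apply: contraT => /existsPn nb.
  have : \sum_i f i <= \sum_i b i by apply: leq_sum => i _; rewrite leqNgt nb.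
  by lia.
exists (fun k => b k + (k == i)) => [k|].
  by case: eqP => [->|_]; rewrite ?addn1 ?addn0.
by rewrite big_split /= bn (bigD1 i) //= eqxx big1 ?addn1 // => k /negbTE ->.
Qed.

(** Barycentric coordinates, multiplied by [n] so as to be integers. *)
Definition grid (I : finType) (n : nat) : finType :=
  {a : {ffun I -> 'I_n.+1} | \sum_i a i == n}.

Definition weight (I : finType) n (a : grid I n) (i : I) : nat := val a i.

Lemma weight_sum (I : finType) n (a : grid I n) : \sum_i weight a i = n.
Proof. exact: eqP (valP a). Qed.

Lemma weight_exists (I : finType) n (b : I -> nat) :
  \sum_i b i = n -> exists a : grid I n, forall i, weight a i = b i.
Proof.
move=> bn.
have bE i : (inord (b i) : 'I_n.+1) = b i :> nat.
  by rewrite inordK // ltnS -bn (bigD1 i) //= leq_addr.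
have aP : \sum_i [ffun i => inord (b i) : 'I_n.+1] i == n.
  by apply/eqP; rewrite -[RHS]bn; apply: eq_bigr => i _; rewrite ffunE bE.
exists (exist (fun a : {ffun I -> 'I_n.+1} => \sum_i a i == n) _ aP) => i.
by rewrite /weight /= ffunE bE.
Qed.

Lemma weight_inj (I : finType) n (a b : grid I n) : weight a =1 weight b -> a = b.
Proof. by move=> ab; apply/val_inj/ffunP => i; apply/val_inj/ab. Qed.

Lemma weight_le (I : finType) n (a : grid I n) i : weight a i <= n.
Proof. by rewrite -ltnS; apply: ltn_ord. Qed.

Lemma weight_max (I : finType) n (a : grid I n) i k :
  weight a i = n -> k != i -> weight a k = 0.
Proof.
move=> ai ki; have := weight_sum a; rewrite (bigD1 i) //= (bigD1 k) //= ai.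
by lia.
Qed.

(** Rank the grid points, for each [i], by decreasing [i]-th weight.  If the sum of
    the largest weights [weight (p i) i] of a primitive family exceeded
    [n + #|I| - 1], a grid point would have smaller weights than all of them and
    contradict primitivity.  As the weights of each member sum to [n], the
    members are thus close to these maxima.  The hypothesis on [c] makes the
    colour of a vertex its own index. *)
Lemma rainbow_grid (I : finType) (n : nat) (c : grid I n -> I) :
  1 < #|I| -> 1 < n -> (forall a, 0 < weight a (c a)) ->
  exists q : I -> grid I n, (forall i, c (q i) = i) /\
    forall i j k, weight (q i) k <= weight (q j) k + #|I|.
Proof.
move=> I2 n2 cw.
have /fin_all_exists[delta deltaE] : forall i, exists a : grid I n,
    forall k, weight a k = if k == i then n else 0.
  move=> i; apply: weight_exists.
  by rewrite -big_mkcond big_pred1_eq.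
have delta_uniq a i : weight a i = n -> a = delta i.
  move=> ai; apply: weight_inj => k; rewrite deltaE.
  by have [->//|ki] := eqVneq k i; apply: weight_max ai ki.
pose W := #|grid I n|.
(* Ties are broken by an enumeration that puts the vertices last, so that a
   vertex is above every non-vertex of the same weight. *)
pose tie (a : grid I n) := (a \in codom delta) * W + enum_rank a.
pose r i a := (n - weight a i) * (2 * W) + tie a.
have rk (a : grid I n) : enum_rank a < W by apply: ltn_ord.
have r_inj i : injective (r i).
  move=> a b /(congr1 (modn^~ W)).
  rewrite /r /tie !mulnA !addnA -!mulnDl !modnMDl !modn_small //.
  by move/val_inj/enum_rank_inj.
have delta_min i v : r i (delta i) <= r i v.
  have [/delta_uniq->//|vi] := eqVneq (weight v i) n.
  have := weight_le v i; rewrite /r /tie deltaE eqxx subnn mul0n add0n.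
  have := rk v; have := rk (delta i).
  by case: (_ \in _) => /=; case: (_ \in _) => /=; nia.
have delta_top i k v : k != i -> v \notin codom delta -> r i v < r i (delta k).
  move=> ki vn; rewrite /r /tie (negbTE vn) codom_f deltaE eq_sym (negbTE ki).
  by have := rk v; nia.
have c_delta : cancel delta c.
  move=> i; have := cw (delta i); rewrite deltaE.
  by case: eqP.
have [t0 t0n] : exists t, t \notin codom delta.
  have /card_gt1P[i [j [_ _ ij]]] := I2.
  have [t tE] : exists t : grid I n, forall k, weight t k =
      (if k == i then 1 else 0) + (if k == j then n.-1 else 0).
    by apply: weight_exists; rewrite big_split /= -!big_mkcond !big_pred1_eq; lia.
  exists t; apply/codomP => -[k kt].
  have := tE i; have := tE j; rewrite !eqxx (negbTE ij) eq_sym (negbTE ij) kt !deltaE.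
  by case: eqP; case: eqP; lia.
have [p [/primitiveP[p1 p2] pc]] :=
  rainbow_primitive r_inj delta_min delta_top c_delta I2 t0n.
have r_weight i a b : r i a <= r i b -> weight b i <= weight a i.
  apply: contraTT; rewrite -!ltnNge /r /tie => ab.
  have := weight_le b i; have := rk a; have := rk b.
  by case: (_ \in _) => /=; case: (_ \in _) => /=; nia.
have pmax i k : weight (p k) i <= weight (p i) i.
  apply: r_weight.
  by have [->//|ki] := eqVneq k i; rewrite ltnW // p1.
have ppos i : 0 < weight (p i) i.
  by have [k ck] := pc i; apply: leq_trans (pmax i k); rewrite -[X in weight _ X]ck.
have sum_p : \sum_i (weight (p i) i).-1 < n.
  rewrite ltnNge; apply/negP => /sum_nat_below[b bp /weight_exists[a aE]].
  have [i /r_weight] := p2 a; rewrite aE leqNgt.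
  by rewrite (leq_ltn_trans (bp i)) // ltn_predL.
have sum_p' : \sum_i weight (p i) i < n + #|I|.
  have -> : \sum_i weight (p i) i = \sum_i (weight (p i) i).-1 + #|I|.
    rewrite -sum1_card -big_split /=; apply: eq_bigr => i _.
    by rewrite addn1 prednK.
  by rewrite ltn_add2r.
have close j k : weight (p k) k <= weight (p j) k + #|I|.
  have le : \sum_(i | i != k) weight (p j) i <= \sum_(i | i != k) weight (p i) i.
    by apply: leq_sum.
  move: sum_p' (weight_sum (p j)) le; rewrite (bigD1 k) //= [X in X = n](bigD1 k) //=.
  by lia.
have /fin_all_exists[f fE] := pc.
exists (p \o f); split=> // i j k.
by apply: leq_trans (pmax k (f i)) (close (f j) k).
Qed.

Local Open Scope classical_set_scope.
Local Open Scope ring_scope.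

(** * Convex combinations *)

Section Convex.
Context {R : realType} {X : normedModType R}.
Implicit Types (C : set X).

Lemma convex_setP C : convex_set (C : set (convex_lmodType X)) <->
  forall x y (t : R), 0 <= t <= 1 -> C x -> C y -> C (t *: x + (1 - t) *: y).
Proof.
split=> [cC x y t /andP[t0 t1] Cx Cy|cC x y t /set_mem Cx /set_mem Cy].
  by have := cC x y (Itv01 t0 t1) (mem_set Cx) (mem_set Cy) => /set_mem.
by apply/mem_set/cC; rewrite ?ge0 ?le1.
Qed.

Lemma convex_set_sum C (I : finType) (w : I -> R) (x : I -> X) :
  convex_set (C : set (convex_lmodType X)) ->
  (forall i, 0 <= w i) -> \sum_i w i = 1 -> (forall i, 0 < w i -> C (x i)) ->
  C (\sum_i w i *: x i).
Proof.
move=> /convex_setP cC w0 w1 Cx.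
(* Partial sums are handled up to normalization; total weight 0 is the only
   case in which normalization is impossible. *)
pose P (W : R) (v : X) := (W = 0 /\ v = 0) \/ (0 < W /\ C (W^-1 *: v)).
suff : P (\sum_i w i) (\sum_i w i *: x i).
  by rewrite w1 => -[[/eqP]|[_]]; rewrite ?oner_eq0 // invr1 scale1r.
apply: (big_rec2 P) => [|i W v _ Pv]; first by left.
have := w0 i; rewrite le_eqVlt => /predU1P[<-|wi]; first by rewrite scale0r !add0r.
right; case: Pv => [[-> ->]|[W0 Cv]].
  by rewrite !addr0 scalerA mulVf ?gt_eqF // scale1r; split=> //; apply: Cx.
have WW : 0 < w i + W by apply: addr_gt0.
split=> //; have -> : (w i + W)^-1 *: (w i *: x i + v) =
    (w i / (w i + W)) *: x i + (1 - w i / (w i + W)) *: (W^-1 *: v).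
  rewrite scalerDr !scalerA; congr (_ *: _ + _ *: _); first by rewrite mulrC.
  by field; rewrite ?gt_eqF.
apply: cC => //; last exact: Cx.
by rewrite divr_ge0 ?(ltW wi) ?(ltW WW) //= ler_pdivrMr // mul1r lerDl ltW.
Qed.

Lemma sub_convex_hull (A : set X) : A `<=` convex_hull A.
Proof. exact: sub_smallest. Qed.

Lemma convex_hull_min (A C : set X) : convex_set (C : set (convex_lmodType X)) ->
  A `<=` C -> convex_hull A `<=` C.
Proof. exact: smallest_sub. Qed.

Lemma convex_convex_hull (A : set X) :
  convex_set (convex_hull A : set (convex_lmodType X)).
Proof.
apply/convex_setP => x y t t01 Ax Ay C [cC AC].
by have /convex_setP := cC; apply => //; [apply: Ax|apply: Ay].
Qed.

End Convex.

(** * The Knaster-Kuratowski-Mazurkiewicz theorem *)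

Definition mix (R : realType) (X : normedModType R) (m : nat)
    (x : 'I_m -> X) (v : 'rV[R]_m) : X := \sum_i v ord0 i *: x i.

(** Colour a grid point with an index [i] of its support such that [C i] contains
    the corresponding combination of the [x i]; the covering hypothesis for that
    support provides one.  A rainbow family of the grid then gives one point per
    set, all close to each other. *)
Lemma kkm_approx (R : realType) (X : normedModType R) (m : nat)
    (x : 'I_m.+2 -> X) (C : 'I_m.+2 -> set X) (n : nat) :
  (forall L : {set 'I_m.+2}, L != finset.set0 ->
     forall z, convex_hull [set x i | i in [set` L]] z ->
     exists2 i, i \in L & C i z) ->
  exists v : 'I_m.+2 -> 'rV[R]_m.+2, forall i,
    [/\ C i (mix x (v i)), forall k, 0 <= v i ord0 k <= 1 &
        forall j k, `|v i ord0 k - v j ord0 k| <= m.+2%:R / n.+2%:R].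
Proof.
move=> cover; pose I := 'I_m.+2.
pose coord (a : grid I n.+2) : 'rV[R]_m.+2 :=
  \row_i ((weight a i)%:R / n.+2%:R).
have coordE (a : grid I n.+2) i :
  coord a ord0 i = (weight a i)%:R / n.+2%:R by rewrite mxE.
have colour (a : grid I n.+2) :
    exists i, (0 < weight a i)%N /\ C i (mix x (coord a)).
  pose L : {set I} := [set i | (0 < weight a i)%N]%SET.
  have wsum : \sum_i (weight a i)%:R / n.+2%:R = 1 :> R.
    by rewrite -mulr_suml -natr_sum weight_sum divff // pnatr_eq0.
  have L0 : L != finset.set0.
    apply/negP => /eqP L0; have := weight_sum a; rewrite big1 // => i _.
    apply/eqP; rewrite -leqn0 leqNgt; apply/negP => ai.
    have : i \in L by rewrite inE.
    by rewrite L0 inE.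
  have [|i iL Ci] := cover L L0 (mix x (coord a)); last first.
    by exists i; rewrite inE in iL.
  rewrite /mix; under eq_bigr do rewrite coordE.
  apply: (convex_set_sum (@convex_convex_hull _ _ _) _ wsum) => i.
    by rewrite divr_ge0.
  rewrite pmulr_lgt0 ?invr_gt0 ?ltr0n // => iL.
  by apply: sub_convex_hull; exists i => //=; rewrite inE.
have [c cP] := choice colour.
have I2 : (1 < #|I|)%N by rewrite card_ord.
have [q [cq close]] := rainbow_grid I2 (isT : (1 < n.+2)%N) (fun a => (cP a).1).
exists (coord \o q) => i; split=> /=.
- by have [_] := cP (q i); rewrite cq.
- by move=> k; rewrite coordE divr_ge0 //= ler_pdivrMr ?ltr0n // mul1r ler_nat weight_le.
- move=> j k; rewrite !coordE -mulrBl normrM.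
  rewrite [X in _ * X]ger0_norm ?invr_ge0 // ler_wpM2r ?invr_ge0 //.
  have := close i j k; have := close j i k.
  rewrite card_ord -!(ler_nat R) !natrD => h1 h2.
  by rewrite ler_norml; apply/andP; split; lra.
Qed.

Lemma continuous_combination (R : realType) (X : normedModType R)
    (T : topologicalType) (I : finType) (f : I -> T -> R) (x : I -> X) :
  (forall i, continuous (f i)) -> continuous (fun t => \sum_i f i t *: x i).
Proof.
move=> fc; apply: continuous_big => [|i _ t]; first exact: add_continuous.
by apply: cvgZr_tmp; apply: fc.
Qed.

(** The rainbow families of finer and finer grids shrink to a cluster point of the
    compact cube of coordinates; each [C i] contains one member of every family
    and is closed, hence contains the combination at the cluster point. *)
Lemma kkm (R : realType) (X : normedModType R) (m : nat)
    (x : 'I_m.+1 -> X) (C : 'I_m.+1 -> set X) :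
  (forall i, closed (C i)) ->
  (forall L : {set 'I_m.+1}, L != finset.set0 ->
     forall z, convex_hull [set x i | i in [set` L]] z ->
     exists2 i, i \in L & C i z) ->
  exists z, forall i, C i z.
Proof.
case: m x C => [|m] x C Ccl cover.
  (* The door argument needs two colours; a single set contains the point by
     hypothesis. *)
  exists (x ord0) => i; have i0 : finset.set1 i != finset.set0.
    by apply/set0Pn; exists i; rewrite inE.
  have [|k _] := cover _ i0 (x ord0); last by rewrite (ord1 k) (ord1 i).
  by apply: sub_convex_hull; exists i; rewrite ?(ord1 i) //= inE.
have [v vP] := choice (fun n => kkm_approx n cover).
pose u n := v n ord0.
have ucube : \forall n \near \oo, forall k, `[0, 1]%classic (u n ord0 k).
  by apply: nearW => n k; rewrite /= in_itv; have [_ /(_ k)] := vP n ord0.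
have [w [_ wu]] := @rV_compact R m.+2 (fun=> `[0, 1]%classic)
  (fun=> @segment_compact _ 0 1) (u @ \oo) _ ucube.
have mix_cont : continuous (mix x).
  by apply: continuous_combination => k; apply: coord_continuous.
pose M := m.+2%:R * \sum_k `|x k|.
have dist n i : `|mix x (u n) - mix x (v n i)| <= M / n.+2%:R.
  rewrite /mix -sumrB /M mulr_sumr mulr_suml.
  apply: le_trans (ler_norm_sum _ _ _) _; apply: ler_sum => k _.
  rewrite -scalerBl normrZ mulrAC ler_wpM2r //.
  by have [_ _] := vP n ord0; apply.
exists (mix x w) => i; apply: Ccl => U /nbhs_ballP[e /= e0 eU].
have near_w : nbhs w [set w' | ball (mix x w) (e / 2) (mix x w')].
  by apply: mix_cont; apply: nbhsx_ballx; rewrite divr_gt0.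
have large : (u @ \oo) (u @` [set n | M / n.+2%:R < e / 2]).
  have : \forall n \near \oo, M / (e / 2) < n%:R by exact: nbhs_infty_gtr.
  apply: filterS => n /= Mn; exists n => //=.
  rewrite ltr_pdivrMr ?ltr0n // mulrC -ltr_pdivrMr ?divr_gt0 //.
  by apply: lt_trans Mn _; rewrite ltr_nat.
have [_ [[n /= ne <-] wn]] := wu _ _ large near_w.
exists (mix x (v n i)); split; first by have [] := vP n i.
apply: eU; rewrite (splitr e); apply: ball_triangle wn _.
by rewrite -ball_normE /=; apply: le_lt_trans (dist n i) ne.
Qed.

(** * Equilibria on a compact set *)

Section Equilibria.
Context {R : realType} {X : normedModType R} (sigma : topology_on X).
Implicit Types (psi : X -> X -> R) (A K : set X).

(** The closures of the superlevel sets have the finite intersection property,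
    hence a common point [x].  If [psi x y] were negative, some [y'] would be
    negative on a whole neighbourhood of [x], and [x] would not be in the closure
    for [y']. *)
Lemma compact_equilibria psi A :
  @compact (retop sigma) A -> A !=set0 -> transfer_usc sigma psi A ->
  (forall (m : nat) (y : 'I_m.+1 -> X), (forall i, A (y i)) ->
     exists2 x, A x & forall i,
       @closure (retop sigma) [set z | A z /\ 0 <= psi z (y i)] x) ->
  equilibria psi A !=set0.
Proof.
move=> cA [a Aa] usc fip.
pose cl y := @closure (retop sigma) [set z | A z /\ 0 <= psi z y].
have fI : finI A (fun y => A `&` cl y).
  move=> D' D'A; case sD: (size (enum_fset D')) => [|m].
    exists a => y /= yD; have : y \in enum_fset D' by [].
    by rewrite (size0nil sD).
  pose y (i : 'I_m.+1) := nth a (enum_fset D') i.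
  have Ay i : A (y i).
    by apply/set_mem/D'A; rewrite /y; apply: mem_nth; rewrite sD.
  have [x Ax xy] := fip m y Ay; exists x => z /= zD; split=> //.
  have zm : (index z (enum_fset D') < m.+1)%N by rewrite -sD index_mem; exact: zD.
  have := xy (Ordinal zm); rewrite /y /= (nth_index _ (zD : z \in enum_fset D')).
  exact.
have fF y : A y -> filter_from (finI_from A (fun y => A `&` cl y)) id (A `&` cl y).
  by move=> Ay; exists (A `&` cl y) => //; apply: finI_from1.
have GF := finI_filter fI.
have [|x [Ax xF]] := cA _ GF.
  by apply: filterS (fF a Aa) => ? [].
exists x; split=> // y Ay; rewrite leNgt; apply/negP => xy0.
have [y' Ay' near_x] := usc x y Ax Ay xy0.
have xcl : cl y' x.
  apply: closed_closure => U xU.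
  by have [z [[_ zcl] zU]] := xF _ _ (fF y' Ay') xU; exists z.
have [z [[Az zy'] zn]] := xcl _ near_x.
by have := zn Az; rewrite ltNge zy'.
Qed.

(** [kkm] applies to the [sigma]-closures because a [sigma]-closed set is closed
    for the finer norm topology. *)
Lemma kkm_equilibria psi A : coarser_than_norm sigma ->
  hausdorff_space (retop sigma) ->
  @compact (retop sigma) A -> A !=set0 ->
  convex_set (A : set (convex_lmodType X)) -> transfer_usc sigma psi A ->
  (forall (m : nat) (y : 'I_m.+1 -> X), (forall i, A (y i)) ->
     exists2 x : 'I_m.+1 -> X, (forall i, A (x i)) &
       forall L : {set 'I_m.+1}, L != finset.set0 ->
       forall z, A z -> convex_hull [set x i | i in [set` L]] z ->
       exists2 i, i \in L & 0 <= psi z (y i)) ->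
  equilibria psi A !=set0.
Proof.
move=> coarse hT cA A0 convA usc tqc; apply: compact_equilibria => // m y Ay.
have [x Ax xy] := tqc m y Ay.
pose C i : set X :=
  @closure (retop sigma) [set z | A z /\ 0 <= psi z (y i)].
have [|L L0 z zL|z zC] := @kkm _ _ m x C _ _.
- move=> i; rewrite -openC; apply: coarse.
  by rewrite openC; apply: closed_closure.
- have Az : A z.
    by move: zL; apply: (convex_hull_min convA) => _ [i _ <-]; apply: Ax.
  have [i iL zi] := xy L L0 z Az zL; exists i => //.
  by apply: subset_closure.
- exists z => //; have Acl := compact_closed hT cA; apply: Acl.
  by apply: closure_subset (zC ord0) => ? [].
Qed.

Lemma equilibria_anti_locally_dominated psi A :
  @compact (retop sigma) A -> A !=set0 ->
  transfer_usc sigma psi A -> anti_locally_dominated psi A ->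
  equilibria psi A !=set0.
Proof.
move=> cA A0 usc ald; apply: compact_equilibria => // m y Ay.
have [x Ax /bigmax_leP[_ xy]] := ald m y Ay; exists x => // i.
apply: subset_closure; split=> //.
by have := xy i isT; rewrite lee_fin oppr_le0.
Qed.

(** Otherwise each index [i] has a successor [f i] with [psi (y i) (y (f i)) < 0],
    and the orbit of [ord0] under [f] runs into a cycle along which [psi] is
    negative. *)
Lemma cyclic_dominating_point psi A (m : nat) (y : 'I_m.+1 -> X) :
  cyclically_anti_quasimonotone psi A -> (forall i, A (y i)) ->
  exists i, forall j, 0 <= psi (y i) (y j).
Proof.
move=> cyc Ay; apply: contrapT => none.
have /choice[f fP] : forall i, exists j, psi (y i) (y j) < 0.
  move=> i; apply: contrapT => ni; apply: none; exists i => j.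
  by rewrite leNgt; apply/negP => ij; apply: ni; exists j.
(* The orbit of ord0 first returns to a point already visited, at time a. *)
have /trajectP[a aN eN] := looping_order f ord0.
pose p := (order f ord0 - a).-1.
have pE : order f ord0 = (a + p.+1)%N.
  by rewrite /p prednK ?subn_gt0 // subnKC // ltnW.
pose x (k : 'I_p.+1) := y (iter (a + k) f ord0).
have [k] := cyc p x (fun k => Ay _); apply/negP; rewrite -ltNge /x /=.
have -> : iter (a + k.+1 %% p.+1) f ord0 = f (iter (a + k) f ord0).
  rewrite -iterS -addnS; have [kp|kp] := eqVneq (k.+1 : nat) p.+1.
    by rewrite kp modnn addn0 -pE.
  by rewrite modn_small // ltn_neqAle kp ltn_ord.
exact: fP.
Qed.

Lemma transfer_quasi_convex_kkm psi A (m : nat) (y : 'I_m.+1 -> X) :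
  transfer_quasi_convex psi A -> (forall i, A (y i)) ->
  exists2 x : 'I_m.+1 -> X, (forall i, A (x i)) &
    forall L : {set 'I_m.+1}, L != finset.set0 ->
    forall z, A z -> convex_hull [set x i | i in [set` L]] z ->
    exists2 i, i \in L & 0 <= psi z (y i).
Proof.
move=> tqc Ay; have [x Ax xy] := tqc m y Ay; exists x => // L L0 z _ zL.
apply: contrapT => none; have := xy L L0 z zL; rewrite leNgt => /negP[].
apply/bigmin_gtP; split; first exact: ltry.
move=> i iL; rewrite lte_fin oppr_gt0 ltNge; apply/negP => zi.
by apply: none; exists i.
Qed.

(** If [i] maximizes [psi z (y i)] over [L], the convex set
    [{x : psi z x <= psi z (y i)}] contains all the [y j], hence also [z], and
    [0 <= psi z z <= psi z (y i)]. *)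
Lemma quasi_convex_kkm psi K (m : nat) (y : 'I_m.+1 -> X) :
  (forall x, K x -> quasi_convex_on K (psi x)) ->
  (forall x, K x -> 0 <= psi x x) -> (forall i, K (y i)) ->
  forall L : {set 'I_m.+1}, L != finset.set0 ->
  forall z, K z -> convex_hull [set y i | i in [set` L]] z ->
  exists2 i, i \in L & 0 <= psi z (y i).
Proof.
move=> qc psi0 Ky L /set0Pn[i0 i0L] z Kz zL.
have [i iL imax] := @Order.TotalTheory.arg_maxP _ R _ i0 (fun i => i \in L)
  (fun i => psi z (y i)) i0L.
exists i => //; apply: le_trans (psi0 z Kz) _.
have := convex_hull_min (qc z Kz (psi z (y i))) _ zL.
by case=> // _ [j jL <-]; split=> //; apply: imax.
Qed.

(** The bifunction [(a, b) |-> - psi b a] satisfies [quasi_convex_kkm], which gives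
    [psi (y i) z <= 0]; pseudomonotonicity of [- psi] exchanges the arguments. *)
Lemma pseudomonotone_kkm psi K (m : nat) (y : 'I_m.+1 -> X) :
  pseudomonotone (fun x y => - psi x y) K ->
  (forall y, K y -> quasi_concave_on K (fun x => psi x y)) ->
  (forall x, K x -> psi x x = 0) -> (forall i, K (y i)) ->
  forall L : {set 'I_m.+1}, L != finset.set0 ->
  forall z, K z -> convex_hull [set y i | i in [set` L]] z ->
  exists2 i, i \in L & 0 <= psi z (y i).
Proof.
move=> pm qc psi0 Ky L L0 z Kz zL.
have psi0' x : K x -> 0 <= - psi x x by move=> /psi0 ->; rewrite oppr0.
have [i iL] :=
  @quasi_convex_kkm (fun a b => - psi b a) K m y qc psi0' Ky L L0 z Kz zL.
rewrite oppr_ge0 => yz; exists i => //.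
have := pm (y i) z (Ky i) Kz.
by rewrite oppr_ge0 oppr_le0; apply.
Qed.

(** * From truncations to the whole set *)

(** Homotheties are [sigma]-continuous, so that closed balls are [sigma]-compact
    like the unit ball. *)
Lemma truncation_compact K (n : nat) :
  homothety_continuous sigma -> @compact (retop sigma) (@unit_ball R X) ->
  @closed (retop sigma) K -> (0 < n)%N -> @compact (retop sigma) (truncation K n).
Proof.
move=> hom cB clK n0; have n0R : 0 < n%:R :> R by rewrite ltr0n.
have -> : truncation K n = ((fun x : X => n%:R *: x) @` @unit_ball R X) `&` K.
  apply/seteqP; split=> [x [Kx xn]|_ [[x xB <-] Kx]].
    split=> //; exists (n%:R^-1 *: x); last by rewrite scalerA mulfV ?gt_eqF // scale1r.
    by rewrite /unit_ball /= normrZ ger0_norm ?invr_ge0 // mulrC ler_pdivrMr // mul1r.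
  by split=> //; rewrite normrZ ger0_norm // ler_piMr.
apply: (@compact_closedI (retop sigma)) => //.
apply: (@continuous_compact (retop sigma) (retop sigma)) => //.
by apply: continuous_subspaceT; apply: hom.
Qed.

Lemma truncation_convex K (n : nat) :
  convex_set (K : set (convex_lmodType X)) ->
  convex_set (truncation K n : set (convex_lmodType X)).
Proof.
move=> /convex_setP cK; apply/convex_setP => x y t t01 [Kx xn] [Ky yn].
split; first exact: cK.
case/andP: t01 => t0 t1; have t1' : 0 <= 1 - t by rewrite subr_ge0.
apply: le_trans (ler_normD _ _) _; rewrite !normrZ !ger0_norm //.
by have := ler_wpM2l t0 xn; have := ler_wpM2l t1' yn; lra.
Qed.

(** Every cluster point [x] is an equilibrium.  If [psi x y] were negative, a
    truncation large enough to contain [x], [y] and [truncation K N] would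
    contain some [y'] with [psi z y'] negative for all its [z] near [x], against
    the hypothesis on [y'].  The filter allows for sequences and subsequences
    alike. *)
Lemma equilibria_of_filter psi K (N : nat) (F : set_system X) :
  ProperFilter F -> @compact (retop sigma) (truncation K N) ->
  (forall n : nat, (0 < n)%N -> transfer_usc sigma psi (truncation K n)) ->
  F (truncation K N) -> (forall y, K y -> F [set x | 0 <= psi x y]) ->
  equilibria psi K !=set0.
Proof.
move=> FF cK usc FN Fpsi.
have [x [xN xF]] := cK F FF FN.
exists x; split=> [|y Ky]; first exact: xN.1.
rewrite leNgt; apply/negP => xy0.
pose n := maxn N.+1 (Num.trunc `|y|).+1.
have Nn : truncation K N `<=` truncation K n.
  move=> z [Kz zN]; split=> //; apply: le_trans zN _.
  by rewrite ler_nat /n; apply: leq_trans (leqnSn _) (leq_maxl _ _).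
have yn : truncation K n y.
  split=> //; apply: le_trans (ltW (truncnS_gt _)) _.
  by rewrite ler_nat leq_maxr.
have n0 : (0 < n)%N by rewrite /n leq_max.
have [y' [Ky' _] near_x] := usc n n0 x y (Nn x xN) yn xy0.
have Fy' : F (truncation K N `&` [set x | 0 <= psi x y']).
  by apply: filterI => //; apply: Fpsi.
have [z [[/Nn zn zy'] zU]] := xF _ _ Fy' near_x.
by have := zU zn; rewrite ltNge zy'.
Qed.

(** Each superlevel set of [psi^~ y] contains a tail of [w], and shifting the
    sequences to that tail does not change the limit [d]. *)
Lemma recession_of_sequence psi K (t : nat -> R) (w : nat -> X) (d : X) :
  t @ \oo --> +oo -> (forall k, K (w k)) ->
  cvg_in sigma (fun k => (t k)^-1 *: w k) d ->
  (forall y, K y -> \forall k \near \oo, 0 <= psi (w k) y) ->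
  recession_set sigma psi K d.
Proof.
move=> too Kw wd wpsi; split; first by exists t, w.
move=> y Ky; have [m _ mP] := wpsi y Ky.
apply: ereal_inf_lbound; exists 0 => //=.
exists (fun k => t (k + m)%N), (fun k => w (k + m)%N); split.
- by move: too => /(cvg_comp _ _ (cvg_addnr m)).
- move=> k; rewrite /sublevel /extend_pinfty /= /patch mem_set //= lee_fin oppr_le0.
  by apply: mP; rewrite /= leq_addl.
- by move: wd => /(cvg_comp _ _ (cvg_addnr m)).
Qed.

End Equilibria.

Theorem corollary1 (R : realType) (X : normedModType R)
    (sigma : topology_on X)
    (sigma_hausdorff : hausdorff_space (retop sigma))
    (sigma_coarser : coarser_than_norm sigma)
    (sigma_homothety : homothety_continuous sigma)
    (ball_seq_compact : sequentially_compact sigma (@unit_ball R X))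
    (ball_compact : compact (@unit_ball R X : set (retop sigma)))
    (K : set X) (K_nonempty : K !=set0)
    (K_closed : closed (K : set (retop sigma)))
    (K_convex : convex_set (K : set (convex_lmodType X)))
    (psi : X -> X -> R)
    (psi_K : condition_K sigma psi K)
    (psi_usc : forall n : nat, (0 < n)%N ->
       transfer_usc sigma psi (truncation K n))
    (recession_trivial : recession_set sigma psi K `<=` [set 0])
    (cases :
      (* (i) *)
      (forall n : nat, (0 < n)%N ->
         anti_locally_dominated psi (truncation K n)) \/
      (* (ii) *)
      (forall n : nat, (0 < n)%N ->
         transfer_quasi_convex psi (truncation K n)) \/
      (* (iii) *)
      cyclically_anti_quasimonotone psi K \/
      (* (iv) *)
      ((forall x, K x -> quasi_convex_on K (psi x)) /\
       (forall x, K x -> 0 <= psi x x)) \/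
      (* (v) *)
      [/\ pseudomonotone (fun x y => - psi x y) K,
          (forall y, K y -> quasi_concave_on K (fun x => psi x y)) &
          (forall x, K x -> psi x x = 0)]) :
  equilibria psi K !=set0 /\
  asymptotic_cone sigma (equilibria psi K) = [set 0].
Proof.
have Kcpt n : (0 < n)%N -> @compact (retop sigma) (truncation K n).
  exact: truncation_compact.
have trunc_eq n : truncation_index K n -> equilibria psi (truncation K n) !=set0.
  move=> [n0 Kn0]; have cpt := Kcpt n n0.
  have KKM := kkm_equilibria sigma_coarser sigma_hausdorff cpt Kn0
    (truncation_convex K_convex) (psi_usc n n0).
  case: cases => [ald|[tqc|[cyc|[[qc psi0]|[pm qc psi0]]]]].
  - exact: equilibria_anti_locally_dominated cpt Kn0 (psi_usc n n0) (ald n n0).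
  - by apply: KKM => m y Ky; apply: transfer_quasi_convex_kkm (tqc n n0) Ky.
  - apply: compact_equilibria cpt Kn0 (psi_usc n n0) _ => m y Ky.
    have [i yi] := cyclic_dominating_point cyc (fun i => (Ky i).1).
    by exists (y i) => // j; apply: subset_closure; split.
  - apply: KKM => m y Ky; exists y => // L L0 z [Kz _].
    exact: quasi_convex_kkm qc psi0 (fun i => (Ky i).1) L L0 z Kz.
  - apply: KKM => m y Ky; exists y => // L L0 z [Kz _].
    exact: pseudomonotone_kkm pm qc psi0 (fun i => (Ky i).1) L L0 z Kz.
have S0 : equilibria psi K !=set0.
  have /choice[x xP] : forall n, exists z, truncation_index K n ->
      equilibria psi (truncation K n) z.
    move=> n; have [/trunc_eq[z zP]|no] := pselect (truncation_index K n).
      by exists z.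
    by exists 0 => /no.
  have trunc_near y : K y -> \forall n \near \oo, truncation_index K n /\ truncation K n y.
    move=> Ky; have : \forall n \near \oo, `|y| < n%:R by exact: nbhs_infty_gtr.
    apply: filterS => n yn; have Kny : truncation K n y by split=> //; apply: ltW.
    split=> //; split; last by exists y.
    by rewrite -(ltr_nat R); apply: le_lt_trans yn.
  have [[M xM]|unbounded] :=
      pselect (exists M : R, forall n, truncation_index K n -> `|x n| <= M).
    have [N MN] : exists N : nat, M <= N.+1%:R.
      by exists (Num.trunc M); apply/ltW/truncnS_gt.
    apply: (@equilibria_of_filter _ _ sigma psi K N.+1 (x @ \oo)) => //.
    + exact: Kcpt.
    + have [y0 Ky0] := K_nonempty; have := trunc_near y0 Ky0.
      apply: filterS => n [nI _]; have [[Kx _] _] := xP n nI.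
      by split=> //; apply: le_trans (xM n nI) MN.
    + move=> y Ky; have := trunc_near y Ky; apply: filterS => n [nI yn].
      by have [_] := xP n nI; apply.
  have [phi [w [d [[phi_inc phiI] wK [d0 dK] xw wd]]]] := psi_K x xP unbounded.
  have phi_ge k : (k <= phi k)%N.
    elim: k => // k IH; apply: leq_ltn_trans IH _.
    have := phi_inc k.+1 k; rewrite !leEnat ltnn => /negbT.
    by rewrite -ltnNge.
  have psi_w y : K y -> \forall k \near \oo, 0 <= psi (w k) y.
    move=> Ky; have [m _ mP] := trunc_near y Ky.
    exists m => // k /= mk; have [_ yk] := mP (phi k) (leq_trans mk (phi_ge k)).
    apply: le_trans (xw k y yk); have [_] := xP (phi k) (phiI k); exact.
  have [[N wN]|winfty] :=
      pselect (exists N : nat, forall m, exists k, (m <= k)%N /\ `|w k| <= N%:R).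
    have [j jP] := choice wN.
    have wj_bounded : \forall m \near \oo, truncation K N.+1 (w (j m)).
      apply: nearW => m; split; first by have [] := wK (j m).
      by apply: le_trans (jP m).2 _; rewrite ler_nat.
    apply: (@equilibria_of_filter _ _ sigma psi K N.+1 ((w \o j) @ \oo)) => //.
    + exact: Kcpt.
    + move=> y /psi_w[m _ mP]; exists m => // k /= mk; apply: mP => /=.
      exact: leq_trans mk (jP k).1.
  suff /recession_trivial d00 : recession_set sigma psi K d.
    by move: d0; rewrite d00 eqxx.
  apply: (recession_of_sequence (t := fun k => `|w k|) (w := w)) => //.
  - apply/cvgryPge => A.
    have [m mP] : exists m, forall k, (m <= k)%N -> (Num.trunc A).+1%:R < `|w k|.
      apply: contrapT => none; apply: winfty; exists (Num.trunc A).+1 => m.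
      apply: contrapT => nm; apply: none; exists m => k mk.
      by rewrite ltNge; apply/negP => wk; apply: nm; exists k.
    exists m => // k /= /mP wk; apply: ltW; apply: lt_trans wk.
    exact: truncnS_gt.
  - by move=> k; have [] := wK k.
split=> //; apply/seteqP; split=> [u [t [x [too xS xu]]]|_ ->].
  apply: recession_trivial; apply: recession_of_sequence too _ xu _.
    by move=> k; have [] := xS k.
  by move=> y Ky; apply: nearW => k; have [_] := xS k; apply.
(* Scaling down a fixed equilibrium gives 0 in the cone. *)
have [z zS] := S0; exists (fun k => k.+1%:R), (fun=> z); split=> //.
  apply/cvgryPge => A; have : \forall k \near \oo, A < k%:R by exact: nbhs_infty_gtr.
  by apply: filterS => k /ltW Ak; apply: le_trans Ak _; rewrite ler_nat.
have z0 : (fun k => k.+1%:R^-1 *: z) @ \oo --> (0 : X).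
  by rewrite -(scale0r z); apply: cvgZr_tmp; apply: cvg_harmonic.
move=> U nU; have : nbhs (0 : retop sigma) U by [].
rewrite nbhsE => -[V [Vo V0] VU].
have : nbhs (0 : X) V by apply: open_nbhs_nbhs; split=> //; apply: sigma_coarser.
by move=> /z0; apply: filterS => k; apply: VU.
Qed.
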